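(* There is an absolute constant $K>0$ such that the following holds. Let $\epsilon\in(0,1/8)$ with $1/(8\epsilon)$ a positive integer, $\delta\in(0,1/8)$, and $n\ge Kd^2/(\epsilon^2\delta)$. Let $\mathcal{D}$ be the distribution on $\mathbb{R}^{n\times d}$ which equals $\mathcal{D}_1$ with probability $1/2$ and $\mathcal{D}_{8\epsilon}$ with probability $1/2$. If $\Pi\in\mathbb{R}^{m\times n}$ has column sparsity $s=1$ and is an $(\epsilon,\delta)$-subspace-embedding for $U\sim\mathcal{D}$, then $m=\Omega(d^2/(\epsilon^2\delta))$, i.e. $m\ge c\,d^2/(\epsilon^2\delta)$ for an absolute constant $c>0$.
   Context: For $0<\beta\le1$ with $1/\beta$ a positive integer, the distribution $\mathcal{D}_\beta$ on $n\times d$ matrices is: $U=VW$, where $V\in\mathbb{R}^{n\times (d/\beta)}$ has independent columns, each uniformly distributed over the $n$ standard basis vectors of $\mathbb{R}^n$, and $W\in\mathbb{R}^{(d/\beta)\times d}$ is independent of $V$ with, for each $i=1,\dots,d$, $W_{j,i}=\sigma_j\sqrt\beta$ for $j=(i-1)/\beta+1,\dots,i/\beta$ (independent Rademacher $\sigma_j$) and all other entries zero. A fixed matrix $\Pi\in\mathbb{R}^{m\times n}$ is an $(\epsilon,\delta)$-subspace-embedding for $U\sim\mathcal{D}$ if $\Pr_{U\sim\mathcal{D}}[\forall x\in\mathbb{R}^d,\ (1-\epsilon)\|Ux\|_2\le\|\Pi Ux\|_2\le(1+\epsilon)\|Ux\|_2]\ge1-\delta$. Column sparsity is the maximum number of nonzero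 entries in a column. *)

(* Defs.v *)
From HB Require Import structures.
From mathcomp Require Import all_boot all_order all_algebra.
From mathcomp Require Import boolp classical_sets reals.

Set Implicit Arguments.
Unset Strict Implicit.
Unset Printing Implicit Defensive.

Import Order.TTheory GRing.Theory Num.Theory.
Local Open Scope classical_set_scope.
Local Open Scope ring_scope.

(* The canonical norm on matrices in MathComp-Analysis is the sup norm, hence
   this definition. *)
Definition l2norm (R : realType) (k : nat) (x : 'cV[R]_k) : R :=
  Num.sqrt (\sum_i x i 0 ^+ 2).

Definition col_sparsity (R : realType) (m n : nat) (Pi : 'M[R]_(m, n)) : nat :=
  \max_(j < n) #|[pred i | Pi i j != 0%R]|.

(* The integer d / beta; the truncation is exact when 1 / beta is an integer. *)
Definition dquo (R : realType) (d : nat) (beta : R) : nat :=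
  Num.truncn (d%:R / beta).

(* The columns of V are independent and uniform over the standard basis, and
   independent of the independent uniform signs sigma_j: this is the uniform
   law on the following finite type.  A sample w consists of the indices w.1 j
   of the basis vectors and of the bits w.2 j, with sigma_j = (-1) ^+ w.2 j. *)
Definition sample (R : realType) (n d : nat) (beta : R) : finType :=
  ({ffun 'I_(dquo d beta) -> 'I_n} * {ffun 'I_(dquo d beta) -> bool})%type.

Definition Vmx (R : realType) (n d : nat) (beta : R) (w : sample n d beta) :
    'M[R]_(n, dquo d beta) :=
  \matrix_(a, j) (a == w.1 j)%:R.

(* Indices start at 0: the rows supporting column i are i / beta, ...,
   (i + 1) / beta - 1. *)
Definition Wmx (R : realType) (n d : nat) (beta : R) (w : sample n d beta) :
    'M[R]_(dquo d beta, d) :=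
  \matrix_(j, i) if i%:R / beta <= j%:R < i.+1%:R / beta
                 then (-1) ^+ w.2 j * Num.sqrt beta else 0.

Definition Umx (R : realType) (n d : nat) (beta : R) (w : sample n d beta) :
    'M[R]_(n, d) :=
  Vmx w *m Wmx w.

(* A law on matrices is given by the probability it assigns to each event; the
   laws below have finite support, so that every set is an event. *)
Definition matrix_law (R : realType) (n d : nat) := set 'M[R]_(n, d) -> R.

Definition D_ (R : realType) (n d : nat) (beta : R) : matrix_law R n d :=
  fun E => #|[pred w : sample n d beta | `[< E (Umx w) >]]|%:R
           / #|sample n d beta|%:R.
Arguments D_ {R} n d beta _.

Definition D_mix (R : realType) (n d : nat) (eps : R) : matrix_law R n d :=
  fun E => 2^-1 * D_ n d 1 E + 2^-1 * D_ n d (8 * eps) E.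
Arguments D_mix {R} n d eps _.

Definition subspace_embedding (R : realType) (m n d : nat)
    (D : matrix_law R n d) (eps delta : R) (Pi : 'M[R]_(m, n)) : Prop :=
  1 - delta <=
  D [set U | forall x : 'cV[R]_d,
       (1 - eps) * l2norm (U *m x) <= l2norm (Pi *m (U *m x)) /\
       l2norm (Pi *m (U *m x)) <= (1 + eps) * l2norm (U *m x)].

(* Main.v *)
(** With [k = 1 / (8 eps)] and [N = d k], a matrix drawn from [D_{8 eps}] samples
    [N] columns of [Pi].  Success on [D_1] forces at least 3/4 of the columns of
    [Pi] to have an entry of absolute value at least [1 - eps], necessarily
    their only nonzero entry; its row is the bucket of the column.

    If two distinct sampled columns [v p], [v q] lie in the same bucket, then
    along the four choices of the signs of [p] and [q] the squared norm of
    [Pi U x], with [x] the indicator of their blocks, varies by more than the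
    embedding allows, so at least one of the four choices fails.  A single
    collision thus gives failure probability 1/4, and two disjoint collisions
    give 5/16; the latter is needed because the hypotheses only bound the
    failure probability by [2 delta], which may be close to 1/4.

    A birthday argument shows that collisions have probability of order
    [N^2 / m], and that for [m] below a small multiple of [N^2] two disjoint ones
    occur with probability above 4/5.  The bound on [n] makes repeated columns
    negligible. *)
Require Import Defs.
From HB Require Import structures.
From mathcomp Require Import all_boot all_order all_algebra.
From mathcomp Require Import boolp classical_sets reals.
From mathcomp Require Import zify ring lra.

Set Implicit Arguments.
Unset Strict Implicit.
Unset Printing Implicit Defensive.

Import Order.TTheory GRing.Theory Num.Theory.
Local Open Scope ring_scope.

(** * Averages over independent uniform samples *)

Section IidAverage.
Variables (R : realFieldType) (T : finType).
Implicit Types (f g : seq T -> R) (s : seq T) (t : nat).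

(** Samples form lists, not functions on ['I_t], so that independent blocks are split by [++],
    [take] and [drop]; [avg_ffun] is the way back to the law of [sample]. *)
Fixpoint avg t f : R :=
  if t is t'.+1 then #|T|%:R^-1 * \sum_x avg t' (fun s => f (x :: s))
  else f [::].

Lemma le_avg t f g :
  (forall s, size s = t -> f s <= g s) -> avg t f <= avg t g.
Proof.
elim: t f g => [|t IHt] f g fg /=; first exact: fg.
apply: ler_wpM2l; first by rewrite invr_ge0.
by apply: ler_sum => x _; apply: IHt => s st; apply: fg; rewrite /= st.
Qed.

Lemma eq_avg t f g : f =1 g -> avg t f = avg t g.
Proof. by move=> fg; apply/eqP; rewrite eq_le !le_avg // => s _; rewrite fg. Qed.

Lemma avgD t f g : avg t (fun s => f s + g s) = avg t f + avg t g.
Proof.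
elim: t f g => [|t IHt] f g //=; rewrite -mulrDr -big_split; congr (_ * _).
by apply: eq_bigr => x _; rewrite IHt.
Qed.

Lemma avgZ t a f : avg t (fun s => a * f s) = a * avg t f.
Proof.
elim: t f => [|t IHt] f //=; rewrite mulrCA; congr (_ * _).
by rewrite mulr_sumr; apply: eq_bigr => x _; rewrite IHt.
Qed.

Lemma avgN t f : avg t (fun s => - f s) = - avg t f.
Proof. by rewrite -mulN1r -avgZ; apply: eq_avg => s; rewrite mulN1r. Qed.

Lemma avg_sum (I : finType) t (F : I -> seq T -> R) :
  avg t (fun s => \sum_i F i s) = \sum_i avg t (F i).
Proof.
elim: t F => [|t IHt] F //=.
rewrite (eq_bigr _ (fun x _ => IHt (fun i s => F i (x :: s)))) exchange_big /=.
by rewrite mulr_sumr.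
Qed.

Lemma avg_cat t1 t2 f :
  avg (t1 + t2) f = avg t1 (fun s1 => avg t2 (fun s2 => f (s1 ++ s2))).
Proof.
elim: t1 f => [|t1 IHt] f //=; congr (_ * _).
by apply: eq_bigr => x _; rewrite IHt.
Qed.

(** The head becomes the innermost average: a fresh sample drawn with the others fixed. *)
Lemma avgS t f :
  avg t.+1 f = avg t (fun s => #|T|%:R^-1 * \sum_x f (x :: s)).
Proof. by rewrite avgZ avg_sum. Qed.

Lemma avg_ge0 t f : (forall s, 0 <= f s) -> 0 <= avg t f.
Proof.
move=> f0; elim: t f f0 => [|t IHt] f f0 //=; apply: mulr_ge0 => //.
by rewrite invr_ge0.
by apply: sumr_ge0 => x _; apply: IHt => s.
Qed.

Hypothesis T_gt0 : (0 < #|T|)%N.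

Lemma avg_cst t a : avg t (fun=> a) = a.
Proof.
elim: t => [|t IHt] //=; rewrite IHt sumr_const -[a *+ _]mulr_natl mulKf //.
by rewrite pnatr_eq0 -lt0n.
Qed.

(** A function on [t.+1] points amounts to its value at [ord0] and its restriction to the rest,
    which matches the recursion of [avg]. *)
Lemma avg_ffun t f :
  #|{ffun 'I_t -> T}|%:R^-1 * (\sum_(v : {ffun 'I_t -> T}) f (codom v)) = avg t f.
Proof.
elim: t f => [|t IHt] f.
  have v0 : all_equal_to (ffun0 (card_ord 0) : {ffun 'I_0 -> T}).
    by move=> v; apply/ffunP => -[].
  rewrite card_ffun card_ord expn0 invr1 mul1r.
  rewrite (big_pred1 (ffun0 (card_ord 0))) => [|v]; last by apply/esym/eqP/v0.
  rewrite /=; congr f; apply: size0nil; by rewrite size_codom card_ord.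
pose cons_ffun (u : T * {ffun 'I_t -> T}) : {ffun 'I_t.+1 -> T} :=
  [ffun i => oapp u.2 u.1 (unlift ord0 i)].
have codom_cons u : codom (cons_ffun u) = u.1 :: codom u.2.
  rewrite /codom /image_mem !enumT -!enumT enum_ordSl /= ffunE unlift_none /=.
  by rewrite -map_comp; congr cons; apply: eq_map => i /=; rewrite ffunE liftK.
have cons_bij : bijective cons_ffun.
  exists (fun v : {ffun 'I_t.+1 -> T} =>
      (v ord0, [ffun i : 'I_t => v (lift ord0 i)])) => [[x v]|v].
    rewrite /cons_ffun ffunE unlift_none; congr pair; apply/ffunP => i.
    by rewrite !ffunE liftK.
  apply/ffunP => i; rewrite !ffunE /=; case: unliftP => [j|] ->//=.
  by rewrite ffunE.
rewrite (reindex cons_ffun) /=; last exact: onW_bij.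
rewrite -(pair_big xpredT xpredT (fun x v => f (codom (cons_ffun (x, v))))) /=.
rewrite card_ffun card_ord expnS natrM invfM -mulrA; congr (_ * _).
rewrite mulr_sumr; apply: eq_bigr => x _; rewrite -IHt card_ffun card_ord.
by congr (_ * _); apply: eq_bigr => v _; rewrite codom_cons.
Qed.

(** A fresh sample repeats one of [t] earlier ones with probability at most [t / #|T|], and
    [t ^ 2 + t <= (t + 1) ^ 2]. *)
Lemma avg_not_uniq t :
  avg t (fun s => (~~ uniq s)%:R) <= t%:R ^+ 2 / #|T|%:R.
Proof.
have T0 : 0 < #|T|%:R :> R by rewrite ltr0n.
elim: t => [|t IHt]; first by rewrite /= expr0n mul0r.
rewrite avgS; apply: (@le_trans _ _
  (avg t (fun s => (~~ uniq s)%:R + t%:R / #|T|%:R))).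
  apply: le_avg => s st; rewrite mulrC ler_pdivrMr // mulrDl divfK ?gt_eqF //.
  rewrite -natrM -natrD -natr_sum ler_nat /=.
  apply: (@leq_trans (\sum_x ((~~ uniq s) + (x \in s)))).
    by apply: leq_sum => x _; case: (x \in s) (uniq s) => [] [].
  rewrite big_split /= sum_nat_const mulnC leq_add2l -st.
  by rewrite -big_mkcond sum1_card card_size.
rewrite avgD avg_cst; apply: le_trans (lerD IHt (lexx _)) _.
rewrite -mulrDl ler_pM2r ?invr_gt0 // -natr1; have := ler0n R t; nra.
Qed.

End IidAverage.

Lemma nth_codom_ord T N (v : {ffun 'I_N -> T}) x0 i
    (iN : (i < N)%N) :
  nth x0 (codom v) i = v (Ordinal iN).
Proof.
rewrite (nth_map (Ordinal iN)) ?size_enum_ord //; congr (v _).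
by apply: val_inj; rewrite /= nth_enum_ord.
Qed.

(** * Bucket collisions *)

Lemma not_uniq_pmap (T B : eqType) (c : T -> option B) (x0 : T)
    (s : seq T) :
  ~~ uniq (pmap c s) ->
  exists i j r, [/\ (i < j < size s)%N, c (nth x0 s i) = Some r
                  & c (nth x0 s j) = Some r].
Proof.
elim: s => [|x s IHs] //= nu.
have recur : ~~ uniq (pmap c s) -> exists i j r,
    [/\ (i < j < (size s).+1)%N, c (nth x0 (x :: s) i) = Some r
      & c (nth x0 (x :: s) j) = Some r].
  by case/IHs => i [j] [r] [ij ci cj]; exists i.+1, j.+1, r.
case cx: (c x) nu => [r|] /=; last exact: recur.
rewrite negb_and negbK => /orP[|]; last exact: recur.
rewrite mem_pmap => /mapP[y ys cy].
exists 0%N, (index (c y) [seq c i | i <- s]).+1, r.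
have idx : (index (c y) [seq c i | i <- s] < size s)%N.
  by rewrite -(size_map c) index_mem map_f.
split=> //=; by rewrite -(nth_map x0 None) // nth_index // map_f.
Qed.

Section Collisions.
Variables (R : realFieldType) (T B : finType).
Hypothesis T_gt0 : (0 < #|T|)%N.
Hypothesis B_gt0 : (0 < #|B|)%N.

(* Discarding the light buckets lets [no_collisionS] bound the chance of hitting
   an occupied bucket by the number of occupied buckets alone. *)
Lemma heavy_restriction (c0 : T -> option B) :
  3/4 * #|T|%:R <= #|[pred x | c0 x]|%:R :> R ->
  exists c : T -> option B,
    [/\ forall x r, c x = Some r -> c0 x = Some r,
        #|T|%:R / 2 <= #|[pred x | c x]|%:R :> R
      & forall x r, c x = Some r ->
          #|T|%:R / (4 * #|B|%:R) <= #|[pred y | c y == Some r]|%:R :> R].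
Proof.
move=> c0_mass; set w := #|T|%:R / (4 * #|B|%:R).
have BR : 0 < #|B|%:R :> R by rewrite ltr0n.
pose heavy r := w <= #|[pred y | c0 y == Some r]|%:R.
pose c x := if c0 x is Some r then if heavy r then Some r else None else None.
have cE x r : heavy r -> (c x == Some r) = (c0 x == Some r).
  rewrite /c; case: (c0 x) => [r'|] // hr; case: ifP => // nhr'.
  by apply/esym/eqP => -[rr']; rewrite rr' hr in nhr'.
exists c; split=> [x r||x r].
- by rewrite /c; case: (c0 x) => // r'; case: ifP.
- have split_mass : #|[pred x | c0 x]|%:R <= #|[pred x | c x]|%:R +
      \sum_(r | ~~ heavy r) #|[pred y | c0 y == Some r]|%:R :> R.
    rewrite -natr_sum -natrD ler_nat -!sum1_card.
    under [X in (_ <= _ + X)%N]eq_bigr do rewrite -sum1_card big_mkcond.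
    rewrite exchange_big [X in (X <= _)%N]big_mkcond.
    rewrite [X in (_ <= X + _)%N]big_mkcond -big_split.
    apply: leq_sum => x _; rewrite !inE /c; case cx: (c0 x) => [r|] //=.
    have [hr|nhr] := boolP (heavy r) => //=.
    by rewrite (bigD1 r) //= inE cx eqxx.
  have : \sum_(r | ~~ heavy r) #|[pred y | c0 y == Some r]|%:R <= #|T|%:R / 4 :> R.
    apply: (@le_trans _ _ (\sum_(r | ~~ heavy r) w)).
      by apply: ler_sum => r; rewrite /heavy -ltNge => /ltW.
    rewrite (_ : _ / 4 = \sum_(r : B) w).
      rewrite [leRHS](bigID heavy) /= lerDr sumr_ge0 // => r _.
      by rewrite divr_ge0 // mulr_ge0.
    by rewrite sumr_const -[_ *+ _]mulr_natl /w; field; rewrite gt_eqF.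
  lra.
- rewrite /c; case cx: (c0 x) => [r'|] //; case: ifP => // hr [<-].
  rewrite [X in _ <= X%:R](_ : _ = #|[pred y | c0 y == Some r']|) //.
  by apply: eq_card => y; rewrite !inE cE.
Qed.

Variable c : T -> option B.
Hypothesis c_mass : #|T|%:R / 2 <= #|[pred x | c x]|%:R :> R.
Hypothesis c_heavy : forall x r, c x = Some r ->
  #|T|%:R / (4 * #|B|%:R) <= #|[pred y | c y == Some r]|%:R :> R.

(** [pmap] drops the samples without a bucket, so these never collide. *)
Definition no_collision t : R := avg t (fun s => (uniq (pmap c s))%:R).

(** Collisions between the two independent blocks are ignored. *)
Lemma no_collision_cat t1 t2 :
  no_collision (t1 + t2) <= no_collision t1 * no_collision t2.
Proof.
rewrite /no_collision avg_cat mulrC -avgZ; apply: le_avg => s1 _.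
rewrite mulrC -avgZ; apply: le_avg => s2 _.
rewrite pmap_cat cat_uniq -natrM ler_nat.
by case: (uniq _) => //=; case: (uniq (pmap c s2)); rewrite ?andbF // leq_b1.
Qed.

Lemma no_collision_ge0 t : 0 <= no_collision t.
Proof. exact: avg_ge0. Qed.

Lemma no_collision_le1 t : no_collision t <= 1.
Proof.
rewrite -(avg_cst T_gt0 t (1 : R)); apply: le_avg => s _.
by rewrite lern1 leq_b1.
Qed.

Lemma no_collision_decr t1 t2 :
  (t1 <= t2)%N -> no_collision t2 <= no_collision t1.
Proof.
move/subnKC <-; apply: le_trans (no_collision_cat _ _) _.
by rewrite ler_piMr ?no_collision_le1 ?no_collision_ge0.
Qed.

Lemma no_collision_mul k t : no_collision (k * t) <= no_collision t ^+ k.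
Proof.
elim: k => [|k IHk]; first by rewrite expr0 no_collision_le1.
rewrite mulSn exprS; apply: le_trans (no_collision_cat _ _) _.
by rewrite ler_wpM2l ?no_collision_ge0.
Qed.

Lemma avg_size_pmap t :
  t%:R / 2 <= avg t (fun s : seq T => (size (pmap c s))%:R : R).
Proof.
have T0 : 0 < #|T|%:R :> R by rewrite ltr0n.
elim: t => [|t IHt]; first by rewrite /= mul0r.
rewrite avgS; apply: (@le_trans _ _
  (avg t (fun s => 2^-1 + (size (pmap c s))%:R))).
  rewrite avgD avg_cst // -natr1; move: IHt; lra.
apply: le_avg => s _; rewrite mulrC ler_pdivlMr //.
rewrite (eq_bigr (fun x => (c x : nat)%:R + (size (pmap c s))%:R)); last first.
  by move=> x _ /=; case: (c x) => [y|] /=; rewrite -natrD.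
rewrite big_split sumr_const /= -natr_sum (_ : (\sum_x _)%N = #|[pred x | c x]|).
  by rewrite mulrDl -[_%:R *+ #|_|]mulr_natr lerD2r mulrC.
rewrite -sum1_card [RHS]big_mkcond; apply: eq_bigr => x _.
by rewrite inE; case: (c x).
Qed.

(* On collision-free samples the number of occupied buckets is the number of
   samples in a bucket, whose mean is at least [t / 2]; samples with a collision
   contribute at most [t] to that mean. *)
Lemma no_collisionS t :
  no_collision t.+1 <=
    no_collision t - t%:R / (4 * #|B|%:R) * (no_collision t - 1 / 2).
Proof.
have T0 : 0 < #|T|%:R :> R by rewrite ltr0n.
have B0 : 0 < #|B|%:R :> R by rewrite ltr0n.
have w0 : 0 <= (4 * #|B|%:R)^-1 :> R by rewrite invr_ge0 mulr_ge0.
(* Each occupied bucket catches the fresh sample with probability at least [1 / (4 * #|B|)]. If [s]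
   already has a collision, the term in [t] keeps the bound nonnegative. *)
rewrite [leLHS]avgS; apply: (@le_trans _ _ (avg t (fun s : seq T =>
    (uniq (pmap c s))%:R + (4 * #|B|%:R)^-1 * (t%:R * (1 - (uniq (pmap c s))%:R)
      - (size (pmap c s))%:R)))); last first.
  rewrite avgD avgZ avgD avgZ avgD !avgN (avg_cst T_gt0 t (1 : R)) -/(no_collision t).
  have := ler_wpM2l w0 (avg_size_pmap t); set u := avg _ _; lra.
apply: le_avg => s st.
have size_s : (size (pmap c s) <= t)%N by rewrite -st size_pmap count_size.
have [us|nus] := boolP (uniq (pmap c s)); last first.
  rewrite big1 ?mulr0 ?add0r ?subr0 ?mulr1 => [|x _].
    by rewrite mulr_ge0 // subr_ge0 ler_nat.
  by rewrite /=; case: (c x) => [y|] /=; rewrite (negbTE nus) ?andbF.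
rewrite subrr mulr0 sub0r mulrN mulrC ler_pdivrMr // mulrBl mul1r.
rewrite lerBrDr; have -> : (4 * #|B|%:R)^-1 * (size (pmap c s))%:R * #|T|%:R
  = \sum_(r <- pmap c s) #|T|%:R / (4 * #|B|%:R) :> R.
  rewrite big_const_seq count_predT iter_addr_0 -[_ *+ _]mulr_natl; field.
  by rewrite gt_eqF.
apply: (@le_trans _ _ (\sum_x (uniq (pmap c (x :: s)))%:R +
    \sum_(r <- pmap c s) #|[pred y | c y == Some r]|%:R)).
  rewrite lerD2l big_seq [leRHS]big_seq; apply: ler_sum => r.
  by rewrite mem_pmap => /mapP[x _ /esym/c_heavy].
rewrite -!natr_sum -natrD ler_nat.
under [X in (_ + X <= _)%N]eq_bigr do rewrite -sum1_card big_mkcond.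
rewrite exchange_big -big_split -sum1_card /=.
apply: leq_sum => x _; case cx: (c x) => [r|] /=; last first.
  by rewrite us big1 // => r _; rewrite inE cx.
rewrite us andbT -[X in (_ + X <= _)%N]big_mkcond.
rewrite (eq_bigl (pred1 r)) => [|r']; last by rewrite !inE cx eq_sym.
by rewrite sum1_count count_uniq_mem //; case: (r \in _).
Qed.

(** By monotonicity the factor [no_collision - 1 / 2] in [no_collisionS] exceeds [1 / 4] at all
    earlier times, so step [i] loses at least [i / (16 * #|B|)]; these losses are summed over
    [i < t]. *)
Lemma no_collision_birthday t :
  3 / 4 < no_collision t ->
  no_collision t <= 1 - (t * t.-1)%:R / (32 * #|B|%:R).
Proof.
have B0 : 0 < #|B|%:R :> R by rewrite ltr0n.
elim: t => [|t IHt] lt_t; first by rewrite mul0n mul0r subr0 no_collision_le1.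
have lt_t' := lt_le_trans lt_t (no_collision_decr (leqnSn t)).
apply: le_trans (no_collisionS t) _.
have /(ler_wpM2l (_ : 0 <= t%:R / (4 * #|B|%:R) :> R)) : 1/4 <= no_collision t - 1/2.
  by lra.
move/(_ (divr_ge0 (ler0n _ _) (mulr_ge0 (ler0n _ 4) (ltW B0)))).
have -> : (t.+1 * t.+1.-1)%:R / (32 * #|B|%:R) =
    (t * t.-1)%:R / (32 * #|B|%:R) + t%:R / (4 * #|B|%:R) * (1/4) :> R.
  have -> : (t.+1 * t.+1.-1)%N = (t * t.-1 + 2 * t)%N by case: (t) => //=; lia.
  rewrite natrD natrM; field; by rewrite gt_eqF.
move: (IHt lt_t'); lra.
Qed.

End Collisions.

(** * Random signs *)

Section SignFlips.
Variables (N : nat).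
Implicit Types (s : {ffun 'I_N -> bool}) (p q : 'I_N).

Definition flip p s : {ffun 'I_N -> bool} := [ffun j => (j == p) (+) s j].

Lemma flipK p : involutive (flip p).
Proof. by move=> s; apply/ffunP => j; rewrite !ffunE addKb. Qed.

Lemma flipC p q s : flip p (flip q s) = flip q (flip p s).
Proof. by apply/ffunP => j; rewrite !ffunE addbCA. Qed.

Lemma sum_flip p (F : {ffun 'I_N -> bool} -> nat) :
  (\sum_s F (flip p s) = \sum_s F s)%N.
Proof. by rewrite [RHS](reindex (flip p)) //=; apply/onW_bij/inv_bij/flipK. Qed.

(* [b] is the parity for which the contributions of [p] and [q] to their common
   bucket have opposite signs. *)
Definition breaks_pair (F : pred {ffun 'I_N -> bool}) p q :=
  exists b : bool, forall s, s p (+) s q = b ->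
    [|| F (flip p s), F (flip q s) | F (flip p (flip q s))].

(** Flipping [p] reverses the parity, so [s] or [flip p s] has parity [b], and both have the same
    orbit under the two flips. *)
Lemma breaks_pair_orbit F p q s : p != q -> breaks_pair F p q ->
  (0 < F s + F (flip p s) + F (flip q s) + F (flip p (flip q s)))%N.
Proof.
move=> pq [b Fb].
have [sb|sb] := eqVneq (s p (+) s q) b.
  have := Fb s sb.
  by do 4!case: (F _).
have := Fb (flip p s); rewrite flipK flipC flipK.
rewrite !ffunE eqxx (eq_sym q) (negbTE pq) /= => FF.
have parity : ~~ s p (+) s q = b.
  by clear Fb FF; move: sb; case: (s p); case: (s q); case: b.
have := FF parity; rewrite flipC [flip q (flip p s)]flipC.
by do 4!case: (F _).
Qed.

Lemma card_signs : #|{ffun 'I_N -> bool}| = (2 ^ N)%N.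
Proof. by rewrite card_ffun card_bool card_ord. Qed.

(** Flips preserve the uniform law, so the count over orbits of four points averages to four times
    the count of [F]. *)
Lemma breaks_pair_quarter (F : pred {ffun 'I_N -> bool}) p q :
  p != q -> breaks_pair F p q -> (2 ^ N <= 4 * \sum_s F s)%N.
Proof.
move=> pq Fpq; have -> : (4 * \sum_s F s = \sum_s (F s + F (flip p s) +
    F (flip q s) + F (flip p (flip q s))))%N.
  rewrite !big_split /= (sum_flip p (fun s => (F s : nat))).
  rewrite (sum_flip q (fun s => (F s : nat))).
  rewrite (sum_flip q (fun s => (F (flip p s) : nat))).
  by rewrite (sum_flip p (fun s => (F s : nat))) !mulSn mul0n addn0 !addnA.
rewrite -card_signs -sum1_card; apply: leq_sum => s _.
exact: breaks_pair_orbit.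
Qed.

(* Let [S_ true] and [S_ false] count the failures with parity [b] and the others.
   The pair [p, q] gives [2 S_ false + S_ true >= 2 ^ N / 2]; flipping [p'] and
   [q'] preserves the parity, so [S_ true] is at least a quarter of [2 ^ N / 2]. *)
Lemma breaks_two_pairs (F : pred {ffun 'I_N -> bool}) p q p' q' :
  p != q -> p' != q' -> p' \notin [:: p; q] -> q' \notin [:: p; q] ->
  breaks_pair F p q -> breaks_pair F p' q' ->
  (5 * 2 ^ N <= 16 * \sum_s F s)%N.
Proof.
rewrite !inE !negb_or => pq pq' /andP[p'p p'q] /andP[q'p q'q] [b Fb] Fpq'.
pose M s := s p (+) s q == b.
have M_p s : M (flip p s) = ~~ M s.
  rewrite /M !ffunE eqxx (eq_sym q) (negbTE pq).
  by case: (s p); case: (s q); case: (b).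
have M_q s : M (flip q s) = ~~ M s.
  rewrite /M !ffunE eqxx (negbTE pq).
  by case: (s p); case: (s q); case: (b).
have M_p' s : M (flip p' s) = M s.
  by rewrite /M !ffunE ![_ == p']eq_sym (negbTE p'p) (negbTE p'q).
have M_q' s : M (flip q' s) = M s.
  by rewrite /M !ffunE ![_ == q']eq_sym (negbTE q'p) (negbTE q'q).
pose S_ b := (\sum_s (F s && (M s == b)))%N.
have sumF : (\sum_s F s = S_ true + S_ false)%N.
  by rewrite -big_split; apply: eq_bigr => s _ /=; case: (F s) (M s) => [] [].
have sumM : (2 * \sum_s M s = 2 ^ N)%N.
  rewrite mul2n -addnn -{1}(sum_flip p (fun s => (M s : nat))).
  rewrite -big_split -card_signs -sum1_card /=.
  by apply: eq_bigr => s _; rewrite M_p; case: (M s).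
(* From parity [b], each single flip leads to the other parity and the double flip back to [b],
   hence the weights 2 and 1. *)
have minus1 : (\sum_s M s <= 2 * S_ false + S_ true)%N.
  have S_flip r : S_ false = (\sum_s (F (flip r s) && (M (flip r s) == false)))%N.
    by rewrite (sum_flip r (fun s => (F s && (M s == false) : nat))).
  rewrite mul2n -addnn {1}(S_flip p) (S_flip q).
  have -> : S_ true = (\sum_s (F (flip p (flip q s)) &&
      (M (flip p (flip q s)) == true)))%N.
    rewrite (sum_flip q (fun s => (F (flip p s) && (M (flip p s) == true) : nat))).
    by rewrite (sum_flip p (fun s => (F s && (M s == true) : nat))).
  rewrite -!big_split; apply: leq_sum => s _ /=; rewrite !M_p !M_q.
  case: (boolP (M s)) => //= /eqP /Fb.
  by do 3!case: (F _).
have minus2 : (\sum_s M s <= 4 * S_ true)%N.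
  have -> : (4 * S_ true = \sum_s ((F s + F (flip p' s) +
      F (flip q' s) + F (flip p' (flip q' s))) * M s))%N.
    under eq_bigr do rewrite !mulnDl !mulnb.
    rewrite !big_split /=; set G := fun s => (F s && (M s == true) : nat).
    have -> : (\sum_s (F s && M s) = S_ true)%N.
      by apply: eq_bigr => s _; rewrite eqb_id.
    have -> : (\sum_s (F (flip p' s) && M s) = S_ true)%N.
      rewrite -[RHS](sum_flip p' G); apply: eq_bigr => s _.
      by rewrite /G M_p' eqb_id.
    have -> : (\sum_s (F (flip q' s) && M s) = S_ true)%N.
      rewrite -[RHS](sum_flip q' G); apply: eq_bigr => s _.
      by rewrite /G M_q' eqb_id.
    have -> : (\sum_s (F (flip p' (flip q' s)) && M s) = S_ true)%N.
      rewrite -[RHS](sum_flip p' G) -[RHS](sum_flip q' (G \o flip p')).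
      by apply: eq_bigr => s _; rewrite /G /= M_p' M_q' eqb_id.
    lia.
  apply: leq_sum => s _; case: (M s); rewrite // muln1.
  exact: breaks_pair_orbit.
(* Half of [2 * S_ false + S_ true] plus half of [S_ true] gives [1 / 4 + 1 / 16 = 5 / 16]. *)
lia.
Qed.

End SignFlips.

(** * Failure of the embedding *)

Section Embedding.
Variable R : realType.

Lemma sqr_l2norm n (x : 'cV[R]_n) : l2norm x ^+ 2 = \sum_i x i 0 ^+ 2.
Proof. by rewrite sqr_sqrtr // sumr_ge0 // => i _; rewrite sqr_ge0. Qed.

Definition embeds m n d (eps : R) (Pi : 'M[R]_(m, n)) (U : 'M[R]_(n, d)) :=
  forall x : 'cV[R]_d,
    (1 - eps) * l2norm (U *m x) <= l2norm (Pi *m (U *m x)) /\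
    l2norm (Pi *m (U *m x)) <= (1 + eps) * l2norm (U *m x).

Lemma embeds_sqr m n d (eps : R) (Pi : 'M[R]_(m, n)) (U : 'M[R]_(n, d)) x :
  0 <= eps <= 1 -> embeds eps Pi U ->
  (1 - eps) ^+ 2 * l2norm (U *m x) ^+ 2 <= l2norm (Pi *m (U *m x)) ^+ 2
    <= (1 + eps) ^+ 2 * l2norm (U *m x) ^+ 2.
Proof.
move=> /andP[e0 e1] /(_ x)[lo hi]; rewrite -!exprMn.
have ge0 j (y : 'cV[R]_j) : 0 <= l2norm y by exact: sqrtr_ge0.
by rewrite !ler_pXn2r ?nnegrE ?lo ?hi ?mulr_ge0 // ?subr_ge0 // addr_ge0.
Qed.

(* Here [a] and [c] are the signed contributions of the two colliding columns to
   their row and [z] that of the other columns. *)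
Lemma two_step_gap (eps C z a c L : R) :
  0 < eps < 8^-1 -> 0 <= L <= 2 ->
  8 * eps * (1 - eps) ^+ 2 <= - (a * c) ->
  (forall g, g \in [:: C + (z - a + c) ^+ 2; C + (z + a - c) ^+ 2;
                       C + (z - a - c) ^+ 2] ->
     (1 - eps) ^+ 2 * L <= g <= (1 + eps) ^+ 2 * L) -> False.
Proof.
move=> /andP[e0 e8] /andP[L0 L2] ac gap.
(* [8 * (7 / 8) ^ 2 > 6]. *)
have ac6 : 6 * eps <= - (a * c) by apply: le_trans ac; nra.
have /gap/andP[l1 u1] : C + (z - a + c) ^+ 2 \in [:: C + (z - a + c) ^+ 2;
  C + (z + a - c) ^+ 2; C + (z - a - c) ^+ 2] by rewrite !inE eqxx.
have /gap/andP[l2 u2] : C + (z + a - c) ^+ 2 \in [:: C + (z - a + c) ^+ 2;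
  C + (z + a - c) ^+ 2; C + (z - a - c) ^+ 2] by rewrite !inE eqxx orbT.
have /gap/andP[l3 u3] : C + (z - a - c) ^+ 2 \in [:: C + (z - a + c) ^+ 2;
  C + (z + a - c) ^+ 2; C + (z - a - c) ^+ 2] by rewrite !inE eqxx !orbT.
have width : (1 + eps) ^+ 2 * L - (1 - eps) ^+ 2 * L <= 8 * eps by nra.
have [P1 P2] : - (2 * eps) <= c * (z - a) /\ c * (z - a) <= 2 * eps.
  have : 4 * (c * (z - a)) = (C + (z - a + c) ^+ 2) - (C + (z - a - c) ^+ 2) by ring.
  by split; lra.
have [Q1 Q2] : - (2 * eps) <= a * (z - c) /\ a * (z - c) <= 2 * eps.
  have : 4 * (a * (z - c)) = (C + (z + a - c) ^+ 2) - (C + (z - a - c) ^+ 2) by ring.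
  by split; lra.
(* This eliminates [z]. As [a] and [c] have opposite signs, the left side is at most
   [2 * eps * |a - c|] in absolute value and the right side at least [6 * eps * |a - c|]. *)
have : a * (c * (z - a)) - c * (a * (z - c)) = - (a * c) * (a - c) by ring.
move: (c * (z - a)) (a * (z - c)) P1 P2 Q1 Q2 => P Q P1 P2 Q1 Q2.
have [a0|a0|a0] := ltgtP a 0.
- have c0 : 0 < c by nra.
  nra.
- have c0 : c < 0 by nra.
  nra.
- by rewrite a0 in ac6; lra.
Qed.

Variables (m n d : nat).
Implicit Types (beta : R) (Pi : 'M[R]_(m, n)).

Lemma col_unique (j : 'I_n) (r r' : 'I_m) Pi :
  (col_sparsity Pi <= 1)%N ->
  Pi r j != 0 -> r' != r -> Pi r' j = 0.
Proof.
move=> sparse Prj r'r; apply/eqP/negPn/negP => Pr'j.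
have := leq_trans (leq_bigmax (F := fun j => #|[pred i | Pi i j != 0]|) j) sparse.
rewrite leqNgt (cardD1 r) inE Prj (cardD1 r') !inE r'r Pr'j.
by [].
Qed.

Lemma Vmx_mul beta (w : sample n d beta) (y : 'cV[R]_(dquo d beta)) a :
  (Vmx w *m y) a 0 = \sum_j (a == w.1 j)%:R * y j 0.
Proof. by rewrite mxE; apply: eq_bigr => j _; rewrite mxE. Qed.

Lemma Pi_Vmx_mul beta Pi (w : sample n d beta) (y : 'cV[R]_(dquo d beta)) r :
  (Pi *m (Vmx w *m y)) r 0 = \sum_j Pi r (w.1 j) * y j 0.
Proof.
rewrite mxE; under eq_bigr do rewrite Vmx_mul mulr_sumr.
rewrite exchange_big; apply: eq_bigr => j _ /=.
rewrite (bigD1 (w.1 j)) //= eqxx mul1r big1 ?addr0 // => a /negbTE ->.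
by rewrite mul0r mulr0.
Qed.

Lemma Vmx_isometry beta (w : sample n d beta) (y : 'cV[R]_(dquo d beta)) :
  injective w.1 -> l2norm (Vmx w *m y) ^+ 2 = \sum_j y j 0 ^+ 2.
Proof.
move=> inj_v; rewrite sqr_l2norm.
have sqE a : (Vmx w *m y) a 0 ^+ 2 = \sum_j (a == w.1 j)%:R * y j 0 ^+ 2.
  rewrite Vmx_mul; have [/codomP[j ->]|av] := boolP (a \in codom w.1).
    rewrite !(bigD1 (P := xpredT) j) //= eqxx !mul1r !big1 ?addr0 // => i ij.
      by rewrite inj_eq // eq_sym (negbTE ij) mul0r.
    by rewrite inj_eq // eq_sym (negbTE ij) mul0r.
  rewrite !big1 ?expr0n // => j _; case: eqP => [aE|]; rewrite ?mul0r //.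
    by rewrite aE codom_f in av.
  by rewrite aE codom_f in av.
under eq_bigr do rewrite sqE.
rewrite exchange_big; apply: eq_bigr => j _ /=.
rewrite (bigD1 (w.1 j)) //= eqxx mul1r big1 ?addr0 // => a /negbTE ->.
by rewrite mul0r.
Qed.

Variables (k : nat) (eps : R) (Pi : 'M[R]_(m, n)).
Hypothesis eps_int : 0 < eps < 8^-1.
Hypothesis kE : (8 * eps)^-1 = k%:R.
Hypothesis sparse : (col_sparsity Pi <= 1)%N.
Local Notation beta := (8 * eps).
Local Notation N := (dquo d beta).

Lemma k_gt1 : (1 < k)%N.
Proof.
by case/andP: eps_int => e0 e1; rewrite -(ltr_nat R) -kE invf_gt1; lra.
Qed.

Lemma dquoE : N = (d * k)%N.
Proof. by rewrite /dquo kE -natrM natrK. Qed.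

Lemma block_lt (j : 'I_N) : (j %/ k < d)%N.
Proof. by rewrite ltn_divLR ?(ltnW k_gt1) // -dquoE. Qed.

Definition in_blocks (p q j : 'I_N) :=
  (j %/ k == p %/ k)%N || (j %/ k == q %/ k)%N.

(** The disjunction keeps the entry equal to 1 when [p] and [q] share a block, so that case needs no
    separate treatment. *)
Definition blocks_vec (p q : 'I_N) : 'cV[R]_d :=
  \col_i (((i : nat) == p %/ k)%N || ((i : nat) == q %/ k)%N)%:R.

Lemma Wmx_blocks_vec (w : sample n d beta) p q j :
  (Wmx w *m blocks_vec p q) j 0 =
  (-1) ^+ w.2 j * (Num.sqrt beta * (in_blocks p q j)%:R).
Proof.
rewrite mxE (bigD1 (Ordinal (block_lt j))) //= big1 => [|i ij].
  rewrite !mxE kE -!natrM ler_nat ltr_nat leq_divM addr0 /=.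
  by rewrite -ltn_divLR ?ltnSn ?(ltnW k_gt1) // mulrA.
rewrite !mxE kE -!natrM ler_nat ltr_nat -leq_divRL ?(ltnW k_gt1) //.
rewrite -ltn_divLR ?(ltnW k_gt1) // ltnS -eqn_leq.
by move: ij; rewrite -val_eqE /= => /negbTE ->; rewrite mul0r.
Qed.

Lemma sum_in_blocks p q : (\sum_j in_blocks p q j <= 2 * k)%N.
Proof.
have block (i : nat) : (\sum_(j < N) (j %/ k == i) <= k)%N.
  have k0 := ltnW k_gt1.
  rewrite -big_mkcond sum1_card -[X in (_ <= X)%N]card_ord.
  apply: (@leq_card_in _ _ (fun j : 'I_N => Ordinal (ltn_pmod j k0))).
  move=> j j' /eqP ji /eqP j'i [jj']; apply: val_inj => /=.
  by rewrite (divn_eq j k) (divn_eq j' k) ji j'i jj'.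
rewrite mul2n -addnn; apply: leq_trans (leq_add (block (p %/ k)%N) (block (q %/ k)%N)).
rewrite -big_split; apply: leq_sum => j _; rewrite /in_blocks /=.
by case: (_ == _) => //; case: (_ == _).
Qed.

(** The test vector is [blocks_vec p q]. By sparsity the two flips change its image only in row [r],
    where [two_step_gap] applies. *)
Lemma flip_breaks_embedding (v : {ffun 'I_N -> 'I_n}) (p q : 'I_N) r :
  injective v -> p != q ->
  1 - eps <= `|Pi r (v p)| -> 1 - eps <= `|Pi r (v q)| ->
  breaks_pair (fun s => ~~ `[< embeds eps Pi (Umx ((v, s) : sample n d beta)) >])
    p q.
Proof.
move=> inj_v pq Pp Pq.
have [e0 e8] := andP eps_int.
have Prp : Pi r (v p) != 0 by rewrite -normr_gt0; apply: lt_le_trans Pp; lra.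
have Prq : Pi r (v q) != 0 by rewrite -normr_gt0; apply: lt_le_trans Pq; lra.
(* Entries of equal sign require opposite random signs, and conversely. *)
exists (0 < Pi r (v p) * Pi r (v q)) => s sb.
rewrite -!negb_and; apply/negP => /and3P[/asboolP E1 /asboolP E2 /asboolP E3].
pose b := Num.sqrt beta.
have bb : b * b = beta by rewrite -expr2 sqr_sqrtr //; lra.
pose y (s' : {ffun 'I_N -> bool}) j : R := (-1) ^+ s' j * (b * (in_blocks p q j)%:R).
pose L := \sum_j (b * (in_blocks p q j)%:R) ^+ 2.
have L02 : 0 <= L <= 2.
  rewrite sumr_ge0 => [/=|j _]; last exact: sqr_ge0.
  have -> : L = beta * (\sum_j in_blocks p q j)%:R.
    rewrite natr_sum mulr_sumr; apply: eq_bigr => j _.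
    by rewrite exprMn expr2 bb; case: in_blocks; rewrite ?expr1n ?expr0n.
  apply: (@le_trans _ _ (beta * (2 * k)%:R)).
    by rewrite ler_pM2l ?ler_nat ?sum_in_blocks //; lra.
  by rewrite natrM -kE mulrCA divff ?mulr1 ?mulf_neq0 ?gt_eqF.
pose z r' := \sum_(j | (j != p) && (j != q)) Pi r' (v j) * y s j.
pose C := \sum_(r' | r' != r) z r' ^+ 2.
(* [G s'] is the squared norm of the image for every [s'] that agrees with [s] off [p] and [q]; [C],
   from the other rows, is common to all of them. *)
pose G s' := C + (Pi r (v p) * y s' p + (Pi r (v q) * y s' q + z r)) ^+ 2.
have G_bound (s' : {ffun 'I_N -> bool}) :
    (forall j, j != p -> j != q -> s' j = s j) ->
    embeds eps Pi (Umx ((v, s') : sample n d beta)) ->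
    (1 - eps) ^+ 2 * L <= G s' <= (1 + eps) ^+ 2 * L.
  move=> s's; have e01 : 0 <= eps <= 1 by apply/andP; split; lra.
  move=> /(embeds_sqr (blocks_vec p q) e01).
  set w : sample n d beta := (v, s').
  rewrite /Umx -mulmxA Vmx_isometry // sqr_l2norm.
  rewrite (_ : \sum_j _ = L); last first.
    apply: eq_bigr => j _; rewrite Wmx_blocks_vec exprMn sqrr_sign mul1r //.
  rewrite (_ : \sum_i _ = G s') // (bigD1 r) //= addrC.
  have rowE r' : (Pi *m (Vmx w *m (Wmx w *m blocks_vec p q))) r' 0 =
      Pi r' (v p) * y s' p + (Pi r' (v q) * y s' q + z r').
    rewrite Pi_Vmx_mul (bigD1 p) //= (bigD1 q) 1?eq_sym //=.
    rewrite !Wmx_blocks_vec; congr (_ + (_ + _)).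
    apply: eq_bigr => j /andP[jp jq]; rewrite Wmx_blocks_vec /y s's //.
  rewrite rowE; congr (_ + _); apply: eq_bigr => r' r'r.
  by rewrite rowE !(col_unique sparse _ r'r) // !mul0r !add0r.
pose a := Pi r (v p) * y s p; pose c := Pi r (v q) * y s q.
have in_p : in_blocks p q p by rewrite /in_blocks eqxx.
have in_q : in_blocks p q q by rewrite /in_blocks eqxx orbT.
have qp : q != p by rewrite eq_sym.
have fpp s' : y (flip p s') p = - y s' p.
  by rewrite /y !ffunE eqxx /= signrN mulNr.
have fqq s' : y (flip q s') q = - y s' q.
  by rewrite /y !ffunE eqxx /= signrN mulNr.
have fpq s' : y (flip p s') q = y s' q by rewrite /y !ffunE (negbTE qp).
have fqp s' : y (flip q s') p = y s' p by rewrite /y !ffunE (negbTE pq).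
apply: (@two_step_gap eps C (z r) a c L eps_int L02).
  have -> : - (a * c) = beta * (`|Pi r (v p)| * `|Pi r (v q)|).
    rewrite -normrM /a /c /y in_p in_q !mulr1.
    have prodE (u u' e e' f : R) :
      u * (e * f) * (u' * (e' * f)) = e * e' * (u * u') * (f * f) by ring.
    rewrite prodE bb -signr_addb sb [in RHS]mulrC -mulNr; congr (_ * _).
    case: ltrgt0P (mulf_neq0 Prp Prq) => [||->]; rewrite ?eqxx // => _ _.
      by rewrite expr1 mulN1r opprK.
    by rewrite expr0 mul1r.
  by rewrite ler_pM2l ?expr2 ?ler_pM //; lra.
have add1 (a' c' z' : R) : - a' + (c' + z') = z' - a' + c' by ring.
have add2 (a' c' z' : R) : a' + (- c' + z') = z' + a' - c' by ring.
have add3 (a' c' z' : R) : - a' + (- c' + z') = z' - a' - c' by ring.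
move=> g; rewrite !inE => /or3P[] /eqP ->.
- have := G_bound (flip p s).
  rewrite /G fpp fpq; rewrite mulrN add1.
  by apply=> // j jp jq; rewrite ffunE (negbTE jp).
- have := G_bound (flip q s).
  rewrite /G fqq fqp; rewrite mulrN add2.
  by apply=> // j jp jq; rewrite ffunE (negbTE jq).
- have := G_bound (flip p (flip q s)).
  rewrite /G fpp fpq fqq fqp; rewrite !mulrN add3.
  by apply=> // j jp jq; rewrite !ffunE (negbTE jp) (negbTE jq).
Qed.

End Embedding.

(** * Failure probabilities and the mass of the buckets *)

Section Laws.
Variables (R : realType) (m n d : nat) (eps : R) (Pi : 'M[R]_(m, n)).
Hypothesis n_gt0 : (0 < n)%N.
Implicit Types (beta : R).

Let In_gt0 : (0 < #|'I_n|)%N. Proof. by rewrite card_ord. Qed.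

(** [f] bounds from below the failure probability conditional on the basis vectors, with only the
    signs random. *)
Lemma avg_le_failure beta (f : seq 'I_n -> R) :
  (forall v : {ffun 'I_(dquo d beta) -> 'I_n},
     f (codom v) * (2 ^ dquo d beta)%:R <=
     (\sum_s ~~ `[< embeds eps Pi (Umx ((v, s) : sample n d beta)) >])%:R) ->
  avg (dquo d beta) f <= 1 - D_ n d beta (embeds eps Pi).
Proof.
set N := dquo d beta; move=> f_le.
have S0 : 0 < #|sample n d beta|%:R :> R.
  by rewrite ltr0n card_prod !card_ffun !card_ord card_bool muln_gt0 !expn_gt0 n_gt0.
have N0 : 0 < (2 ^ N)%:R :> R by rewrite ltr0n expn_gt0.
rewrite -avg_ffun // /D_ lerBrDr -(ler_pM2r S0) mul1r mulrDl divfK ?gt_eqF //.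
rewrite mulrAC.
have -> : #|{ffun 'I_N -> 'I_n}|%:R^-1 * #|sample n d beta|%:R = (2 ^ N)%:R :> R.
  rewrite card_prod card_signs natrM mulKf // pnatr_eq0 -lt0n card_ffun.
  by rewrite expn_gt0 In_gt0.
rewrite mulrC mulr_suml.
apply: le_trans (lerD (ler_sum _ (fun v _ => f_le v)) (lexx _)) _.
rewrite -natr_sum -natrD ler_nat.
rewrite (pair_big xpredT xpredT (fun v s =>
  ~~ `[< embeds eps Pi (Umx ((v, s) : sample n d beta)) >] : nat)) /=.
rewrite -!sum1_card [X in (_ + X <= _)%N]big_mkcond -big_split /=.
rewrite [X in (X <= _)%N](_ : _ = \sum_(w : sample n d beta) 1)%N //.
by apply: eq_bigr => -[v s] _; rewrite inE; case: asbool.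
Qed.

(** With column sparsity 1 and [eps < 1] at most one row qualifies, so the choice is canonical. *)
Definition bucket (j : 'I_n) : option 'I_m := [pick r | 1 - eps <= `|Pi r j|].

Lemma bucketP j r : bucket j = Some r -> 1 - eps <= `|Pi r j|.
Proof. by rewrite /bucket; case: pickP => // r' ? [<-]. Qed.

(** For [beta = 1] the columns of [U] are signed basis vectors, and the norm of a column of [Pi] is
    the absolute value of its only nonzero entry. *)
Lemma embeds_bucket (w : sample n d (1 : R)) (j : 'I_(dquo d (1 : R))) :
  0 < eps < 8^-1 -> (col_sparsity Pi <= 1)%N ->
  embeds eps Pi (Umx w) -> bucket (w.1 j).
Proof.
move=> /andP[e0 e8] sparse.
have dq : dquo d (1 : R) = d by rewrite /dquo divr1 natrK.
pose i0 := cast_ord dq j.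
move=> /(_ (delta_mx i0 0))[+ _].
have WxE : Wmx w *m (delta_mx i0 0 : 'cV[R]_d) =
    (-1) ^+ w.2 j *: (delta_mx j 0 : 'cV[R]_(dquo d 1)).
  apply/colP => a; rewrite mxE (bigD1 i0) //= big1 => [|i ij].
    rewrite !mxE !eqxx !divr1 ler_nat ltr_nat ltnS -eqn_leq sqrtr1 mulr1 addr0.
    by rewrite mulr1 andbT eq_sym /i0 /= val_eqE; case: eqP => [->|]; rewrite ?mulr1 ?mulr0.
  by rewrite !mxE (negbTE ij) mulr0.
have -> : l2norm (Umx w *m delta_mx i0 0) = 1.
  rewrite /l2norm -mulmxA WxE (bigD1 (w.1 j)) //= Vmx_mul (bigD1 j) //=.
  rewrite !mxE !eqxx mul1r !mulr1 big1 => [|i /negbTE ij]; last first.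
    by rewrite !mxE ij !mulr0.
  rewrite addr0 sqrr_sign big1 ?addr0 ?sqrtr1 // => a /negbTE aj.
  rewrite Vmx_mul big1 ?expr0n // => i _; rewrite !mxE.
  by case: eqP => [ai|]; rewrite ?mul0r //; case: eqP => [ij|]; rewrite ?mulr0 //;
    rewrite ai ij eqxx in aj.
rewrite mulr1 => norm_ge; rewrite /bucket; case: pickP => //= small.
have PiUE r : (Pi *m (Umx w *m (delta_mx i0 0 : 'cV[R]_d))) r 0 =
    (-1) ^+ w.2 j * Pi r (w.1 j).
  rewrite /Umx -mulmxA WxE Pi_Vmx_mul (bigD1 j) //= big1 => [|i /negbTE ij].
    by rewrite !mxE !eqxx mulr1 addr0 mulrC.
  by rewrite !mxE ij !mulr0.
case: (pickP (fun r => Pi r (w.1 j) != 0)) => [r Pr|P0].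
  suff normE : l2norm (Pi *m (Umx w *m (delta_mx i0 0 : 'cV[R]_d))) = `|Pi r (w.1 j)|.
    by have := small r; rewrite -normE norm_ge.
  rewrite /l2norm (bigD1 r) //= big1 => [|r' r'r].
    by rewrite addr0 PiUE exprMn sqrr_sign mul1r sqrtr_sqr.
  by rewrite PiUE (col_unique sparse Pr r'r) mulr0 expr0n.
move: norm_ge; rewrite /l2norm big1 ?sqrtr0 => [|r _]; first by lra.
by rewrite PiUE; move/negbFE/eqP: (P0 r) => ->; rewrite mulr0 expr0n.
Qed.

(** The first sampled column alone, uniform over the columns of [Pi], causes failure whenever it has
    no bucket. *)
Lemma bucket_mass (delta : R) :
  (0 < d)%N -> 0 < eps < 8^-1 -> (col_sparsity Pi <= 1)%N ->
  1 - delta <= D_ n d 1 (embeds eps Pi) ->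
  (1 - delta) * #|'I_n|%:R <= #|[pred j | bucket j]|%:R :> R.
Proof.
move=> d0 eps_int sparse.
have dq : dquo d (1 : R) = d by rewrite /dquo divr1 natrK.
have j0P : (0 < dquo d (1 : R))%N by rewrite dq.
have n0 : 0 < #|'I_n|%:R :> R by rewrite ltr0n.
pose f (s : seq 'I_n) : R := (~~ bucket (nth (Ordinal n_gt0) s 0))%:R.
have : avg (dquo d (1 : R)) f <= 1 - D_ n d 1 (embeds eps Pi).
  apply: avg_le_failure => v; rewrite /f.
  rewrite nth_codom_ord.
  case: (boolP (bucket _)) => [_|nb]; first by rewrite mul0r.
  rewrite mul1r ler_nat -card_signs -sum1_card; apply: leq_sum => s _.
  case: asboolP => // /(embeds_bucket (Ordinal j0P) eps_int sparse).
  by rewrite /= (negbTE nb).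
have -> : avg (dquo d (1 : R)) f = 1 - #|[pred j | bucket j]|%:R / #|'I_n|%:R.
  case: (dquo d (1 : R)) j0P => // t _ /=.
  have -> : \sum_x avg t (fun s => f (x :: s)) = \sum_x (~~ bucket x)%:R :> R.
    by apply: eq_bigr => x _; rewrite /f /= avg_cst.
  have -> : \sum_x (~~ bucket x)%:R = #|'I_n|%:R - #|[pred j | bucket j]|%:R :> R.
    apply/eqP; rewrite eq_sym subr_eq -!sum1_card !natr_sum; apply/eqP.
    rewrite [X in _ = _ + X]big_mkcond -big_split /=; apply: eq_bigr => x _.
    by rewrite inE; case: (bucket x) => [?|] /=; rewrite ?addr0 ?add0r.
  by rewrite mulrBr mulVf ?gt_eqF // mulrC.
move=> le_fail le_D; rewrite -ler_pdivlMr //; lra.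
Qed.

End Laws.

(** * From collisions to failure probability *)

Section CollisionsBreak.
Variables (R : realType) (m n d k : nat) (eps : R) (Pi : 'M[R]_(m, n)).
Hypothesis eps_int : 0 < eps < 8^-1.
Hypothesis kE : (8 * eps)^-1 = k%:R.
Hypothesis sparse : (col_sparsity Pi <= 1)%N.
Variable c : 'I_n -> option 'I_m.
Hypothesis c_large : forall j r, c j = Some r -> 1 - eps <= `|Pi r j|.
Local Notation N := (dquo d (8 * eps)).
Implicit Types (v : {ffun 'I_N -> 'I_n}).

Let fails v (s : {ffun 'I_N -> bool}) :=
  ~~ `[< embeds eps Pi (Umx ((v, s) : sample n d (8 * eps))) >].

(** The window from [l] to [l + h] serves for the whole sample and for its two parts; pairs from
    disjoint windows are disjoint. *)
Lemma collision_breaks v l h : uniq (codom v) ->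
  ~~ uniq (pmap c (take h (drop l (codom v)))) ->
  exists p q : 'I_N,
    [/\ (l <= p)%N, (p < q)%N, (q < l + h)%N & breaks_pair (fails v) p q].
Proof.
move=> /injectiveP inj_v nu.
have [x0 _] : exists x0 : 'I_n, True.
  by case: (take h _) nu => // x; exists x.
have [i [j [r []]]] := not_uniq_pmap x0 nu.
rewrite size_take_min size_drop size_codom card_ord leq_min.
move=> /and3P[ij jh jN].
rewrite !nth_take ?(ltn_trans ij) // !nth_drop.
have lj : (l + j < N)%N by rewrite -ltn_subRL.
have li : (l + i < N)%N by rewrite (ltn_trans _ lj) // ltn_add2l.
rewrite !nth_codom_ord => /c_large ci /c_large cj.
exists (Ordinal li), (Ordinal lj); split; rewrite /= ?leq_addr ?ltn_add2l //.
apply: (flip_breaks_embedding eps_int kE sparse inj_v _ ci cj).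
by rewrite -val_eqE /= eqn_add2l ltn_eqF.
Qed.

Lemma collision_fails v : uniq (codom v) -> ~~ uniq (pmap c (codom v)) ->
  (2 ^ N <= 4 * \sum_s fails v s)%N.
Proof.
move=> uv; rewrite -[X in pmap c X]drop0 -[X in pmap c X](@take_oversize _ N).
  move/(collision_breaks uv) => [p [q [_ pq _ breaks]]].
  by apply: breaks_pair_quarter breaks; rewrite -val_eqE /= ltn_eqF.
by rewrite drop0 size_codom card_ord.
Qed.

Lemma two_collisions_fail v M : uniq (codom v) ->
  ~~ uniq (pmap c (take M (codom v))) -> ~~ uniq (pmap c (drop M (codom v))) ->
  (5 * 2 ^ N <= 16 * \sum_s fails v s)%N.
Proof.
move=> uv; rewrite -[X in pmap c (take M X)]drop0.
rewrite -[X in _ -> ~~ uniq (pmap c X) -> _](@take_oversize _ N); last first.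
  by rewrite size_drop size_codom card_ord leq_subr.
move=> /(collision_breaks uv)[p [q [_ pq qM breaks]]].
move=> /(collision_breaks uv)[p' [q' [Mp' pq' _ breaks']]].
apply: breaks_two_pairs breaks breaks'.
all: rewrite ?inE -!val_eqE /=; lia.
Qed.

(** The subtracted term makes the integrand at most 0 on lists with repeated columns, where no
    failure is claimed. *)
Lemma avg_collision :
  (0 < n)%N ->
  1 / 4 * (avg N (fun s => (~~ uniq (pmap c s))%:R - (~~ uniq s)%:R))
    <= 1 - D_ n d (8 * eps) (embeds eps Pi).
Proof.
move=> n0; rewrite -avgZ; apply: avg_le_failure => // v.
have [u|nu] := boolP (uniq (codom v)); last first.
  by apply: le_trans (ler0n _ _); have := ler0n R (2 ^ N); case: (uniq _) => /=; lra.
have [_|nc] := boolP (uniq (pmap c (codom v))).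
  by rewrite subrr mulr0 mul0r ler0n.
have := collision_fails u nc; rewrite -(ler_nat R) natrM /fails.
set x := (2 ^ _)%:R; set y := (\sum_s _)%:R; rewrite /= subr0; lra.
Qed.

Lemma avg_two_collisions M :
  (0 < n)%N ->
  5 / 16 * (avg N (fun s => (~~ uniq (pmap c (take M s)) &&
       ~~ uniq (pmap c (drop M s)))%:R - (~~ uniq s)%:R))
    <= 1 - D_ n d (8 * eps) (embeds eps Pi).
Proof.
move=> n0; rewrite -avgZ; apply: avg_le_failure => // v.
have [u|nu] := boolP (uniq (codom v)); last first.
  by apply: le_trans (ler0n _ _); have := ler0n R (2 ^ N); case: (_ && _) => /=; lra.
have [/andP[nc1 nc2]|_] := boolP (_ && _); last first.
  by rewrite subrr mulr0 mul0r ler0n.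
have := two_collisions_fail u nc1 nc2; rewrite -(ler_nat R) !natrM /fails.
set x := (2 ^ _)%:R; set y := (\sum_s _)%:R; rewrite /= subr0; lra.
Qed.

End CollisionsBreak.

(** * The lower bound on the number of rows *)

(** Union bound: both parts have at least [M] samples, so each lacks a collision with probability at
    most [no_collision R c M]. *)
Lemma two_collisions_likely (R : realFieldType) (T B : finType)
    (c : T -> option B) M N :
  (0 < #|T|)%N -> (2 * M <= N)%N ->
  1 - 2 * no_collision R c M <=
    avg N (fun s => (~~ uniq (pmap c (take M s)) &&
                     ~~ uniq (pmap c (drop M s)))%:R).
Proof.
move=> T0 MN; have -> : N = (M + (N - M))%N by lia.
apply: (@le_trans _ _ (avg (M + (N - M)) (fun s : seq T => 1 +
   - ((uniq (pmap c (take M s)))%:R + (uniq (pmap c (drop M s)))%:R)))).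
  rewrite avgD avg_cst // lerD2l avgN lerN2 avgD.
  rewrite mulrDl mul1r; apply: lerD.
    rewrite avg_cat; apply: le_avg => s1 s1M.
    rewrite -[leRHS](avg_cst T0 (N - M)); apply: le_avg => s2 _.
    by rewrite take_size_cat.
  apply: le_trans (no_collision_decr R T0 c (_ : (M <= N - M)%N)); last by lia.
  rewrite avg_cat -[leRHS](avg_cst T0 M); apply: le_avg => s1 s1M.
  by apply: le_avg => s2 _; rewrite drop_size_cat.
apply: le_avg => s _.
by case: (uniq _); case: (uniq _) => /=; lra.
Qed.

Lemma sqr_leq_two_pairs N : (1 < N)%N -> (N ^ 2 <= 2 * (N * N.-1))%N.
Proof. by case: N => // N; nia. Qed.

(** For [q = N %/ 18], the hypothesis gives [(q + 1) ^ 2 <= 36 * m], and [108 = 18 * 6]. *)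
Lemma sqr_leq_few_pairs N m : (0 < m)%N ->
  (N %/ 18 * (N %/ 18).-1 < 8 * m)%N -> (N ^ 2 <= 108 ^ 2 * m)%N.
Proof.
have : (N < 18 * (N %/ 18).+1)%N by rewrite mulnC -ltn_divLR.
case: (N %/ 18)%N => [|N'] /=; nia.
Qed.

Theorem theorem6 (R : realType) :
  exists K c : R, [/\ 0 < K, 0 < c &
    forall (eps delta : R) (m n d : nat) (Pi : 'M[R]_(m, n)),
      0 < eps < 8^-1 ->
      (8 * eps)^-1 \is a Num.nat ->
      0 < delta < 8^-1 ->
      K * d%:R ^+ 2 / (eps ^+ 2 * delta) <= n%:R ->
      col_sparsity Pi = 1%N ->
      subspace_embedding (D_mix n d eps) eps delta Pi ->
      c * d%:R ^+ 2 / (eps ^+ 2 * delta) <= m%:R].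
Proof.
(* 64 comes from [N ^ 2 = d ^ 2 / (64 * eps ^ 2)], 36 from the threshold on [delta] below, and
   [108 ^ 2] from [sqr_leq_few_pairs]. *)
exists 1, (64 * (36 * 108 ^+ 2))^-1; split=> //.
  by rewrite invr_gt0 !mulr_gt0 ?exprn_gt0.
move=> eps delta m n d Pi eps_int /natrP[k kE] /andP[del0 del8] n_large Pi1.
rewrite /subspace_embedding -/(embeds eps Pi) /D_mix => emb.
have /andP[e0 e8] := eps_int.
have sparse : (col_sparsity Pi <= 1)%N by rewrite Pi1.
have [->|d0] := posnP d; first by rewrite expr0n mulr0 mul0r.
have ed0 : 0 < eps ^+ 2 * delta by rewrite mulr_gt0 ?exprn_gt0.
have n0 : (0 < n)%N.
  rewrite -(ltr_nat R); apply: lt_le_trans n_large.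
  by rewrite mul1r divr_gt0 ?exprn_gt0 ?ltr0n.
have m0 : (0 < m)%N.
  case: m Pi Pi1 {emb sparse} => // Pi; rewrite /col_sparsity big1 // => j _.
  by apply: eq_card0 => -[].
have In0 : (0 < #|'I_n|)%N by rewrite card_ord.
have Im0 : (0 < #|'I_m|)%N by rewrite card_ord.
have D_le1 beta : D_ n d beta (embeds eps Pi) <= 1.
  rewrite -subr_ge0; apply: le_trans (avg_le_failure (f := fun=> 0) n0 _).
    by rewrite avg_cst.
  by move=> v; rewrite mul0r ler0n.
(* Each law has weight [1 / 2] in the mixture, which at most doubles its failure probability. *)
have D1_large : 1 - 2 * delta <= D_ n d 1 (embeds eps Pi).
  by have := D_le1 (8 * eps); lra.
have D8_large : 1 - 2 * delta <= D_ n d (8 * eps) (embeds eps Pi).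
  by have := D_le1 1; lra.
have c0_mass : 3 / 4 * #|'I_n|%:R <= #|[pred j | bucket eps Pi j]|%:R :> R.
  apply: le_trans (bucket_mass n0 d0 eps_int sparse D1_large).
  by rewrite ler_pM2r ?ltr0n //; lra.
have [c [c_c0 c_mass c_heavy]] := heavy_restriction Im0 c0_mass.
have c_large j r : c j = Some r -> 1 - eps <= `|Pi r j|.
  by move=> /c_c0 /bucketP.
set N := dquo d (8 * eps) in D8_large.
have NE : N = (d * k)%N := dquoE d kE.
have k1 := k_gt1 eps_int kE.
have NR : N%:R ^+ 2 = d%:R ^+ 2 / (64 * eps ^+ 2) :> R.
  by rewrite NE natrM -kE; field; rewrite gt_eqF.
have mR : 0 < m%:R :> R by rewrite ltr0n.
have nR : 0 < n%:R :> R by rewrite ltr0n.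
have goalE A : 0 <= A -> A <= 36 * 108 ^+ 2 -> N%:R ^+ 2 <= A * delta * m%:R ->
    (64 * (36 * 108 ^+ 2))^-1 * d%:R ^+ 2 / (eps ^+ 2 * delta) <= m%:R.
  move=> A0 A_le N_le; rewrite ler_pdivrMr //.
  rewrite ler_pdivrMl ?mulr_gt0 ?exprn_gt0 //.
  have -> : d%:R ^+ 2 = 64 * eps ^+ 2 * N%:R ^+ 2 :> R.
    by rewrite NR; field; rewrite gt_eqF.
  apply: (@le_trans _ _ (64 * eps ^+ 2 * (A * delta * m%:R))).
    by rewrite ler_pM2l // mulr_gt0 ?exprn_gt0.
  rewrite (_ : _ * (A * _ * _) = (64 * A) * (m%:R * (eps ^+ 2 * delta))).
    by rewrite ler_pM2r ?mulr_gt0 // ler_pM2l.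
  by ring.
have dup : avg N (fun s : seq 'I_n => (~~ uniq s)%:R) <= delta / 64 :> R.
  apply: le_trans (avg_not_uniq R In0 N) _; rewrite card_ord ler_pdivrMr //.
  move: n_large; rewrite mul1r ler_pdivrMr // => n_large.
  rewrite NR ler_pdivrMr ?mulr_gt0 ?exprn_gt0 //; move: n_large.
  by rewrite (_ : _ / 64 * _ * _ = n%:R * (eps ^+ 2 * delta)) //; field.
have D8_fail : 1 - D_ n d (8 * eps) (embeds eps Pi) <= 2 * delta.
  by rewrite lerBlDl -lerBlDr.
have fail1 := le_trans (avg_collision d eps_int kE sparse c_large n0) D8_fail.
have fail2 M :=
  le_trans (avg_two_collisions d eps_int kE sparse c_large M n0) D8_fail.
have birthday t := no_collision_birthday In0 Im0 c_mass c_heavy (t := t).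
clear emb D1_large D8_large D8_fail D_le1.
have N_gt1 : (1 < N)%N by rewrite NE (leq_trans k1) // leq_pmull.
rewrite -/N avgD avgN in fail1 fail2.
clearbody N.
have noncoll : avg N (fun s => (~~ uniq (pmap c s))%:R) = 1 - no_collision R c N.
  rewrite -[X in X - _](avg_cst In0 N) -avgN -avgD; apply: eq_avg => s.
  by case: (uniq _); rewrite ?subrr ?subr0.
rewrite {}noncoll in fail1.
have {fail2} fail2 M : 5 / 16 * (avg N (fun s => (~~ uniq (pmap c (take M s)) &&
    ~~ uniq (pmap c (drop M s)))%:R) - delta / 64) <= 2 * delta.
  by have := fail2 M; rewrite -/N avgD avgN; move: dup; lra.
have two_ge := two_collisions_likely R c In0.
have alphaX := no_collision_mul R In0 c.
have alpha_ge0 := no_collision_ge0 R c.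
move: (no_collision R c) fail1 birthday two_ge alphaX alpha_ge0.
move=> alpha fail1 birthday two_ge alphaX alpha_ge0.
rewrite card_ord in birthday.
have {}fail1 : 1 - alpha N <= 8 * delta + delta / 64.
  by move: fail1 dup; move: (avg _ _) => u; lra.
have {dup two_ge} fail2 M : (2 * M <= N)%N ->
    5 / 16 * (1 - 2 * alpha M - delta / 64) <= 2 * delta.
  move=> /two_ge; have := fail2 M; move: (avg _ _) => u; lra.
(* For [delta < 1 / 36], [fail1] puts [alpha N] above [3 / 4] and the birthday bound applies to all
   [N] samples. Otherwise [1 / delta] is bounded, and [m] of order [N ^ 2] suffices. *)
have [del_small|del_large] := ltP delta (36^-1).
  (* [576 = 2 * 32 * 9], from [sqr_leq_two_pairs], the birthday bound and
     [1 - alpha N <= 9 * delta]. *)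
  apply: (goalE 576); [lra|lra|].
  have /birthday bN : 3 / 4 < alpha N by lra.
  have : (N * N.-1)%:R / (32 * m%:R) <= 9 * delta by lra.
  rewrite ler_pdivrMr ?mulr_gt0 // => NN.
  have := sqr_leq_two_pairs N_gt1; rewrite -(ler_nat R) natrX natrM => N2.
  apply: le_trans N2 _; move: NN; lra.
(* Each half of the sample contains nine groups of [N %/ 18] columns; were each
   group collision-free with probability at most 3/4, two disjoint collisions
   would be too likely. *)
have few : 3 / 4 < alpha (N %/ 18)%N.
  rewrite ltNge; apply/negP => le34.
  (* 9 is the least exponent [e] with [5 / 16 * (1 - 2 * (3 / 4) ^ e - 1 / 512) > 1 / 4], which
     contradicts [fail2] as [delta < 1 / 8]. *)
  have alpha9 : alpha (N %/ 18)%N ^+ 9 <= (3 / 4) ^+ 9.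
    by rewrite ler_pXn2r ?nnegrE // divr_ge0.
  have halves : (2 * (9 * (N %/ 18)) <= N)%N by rewrite mulnA mulnC leq_trunc_div.
  have := fail2 _ halves; have := le_trans (alphaX 9 (N %/ 18)%N) alpha9.
  move: (alpha _) => u; lra.
have : ((N %/ 18) * (N %/ 18).-1)%:R / (32 * m%:R) < 1 / 4 :> R.
  by have := birthday _ few; lra.
rewrite ltr_pdivrMr ?mulr_gt0 // => NN.
have {NN} NN : (N %/ 18 * (N %/ 18).-1 < 8 * m)%N.
  by rewrite -(ltr_nat R) [ltRHS]natrM; lra.
have := sqr_leq_few_pairs m0 NN; rewrite -(ler_nat R) natrX natrM natrX => N_le.
apply: (goalE (36 * 108 ^+ 2)); rewrite ?mulr_ge0 //.
apply: le_trans N_le _.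
rewrite [leRHS](_ : _ = 36 * delta * (108 ^+ 2 * m%:R)); last by ring.
rewrite ler_peMl ?mulr_ge0 //; lra.
Qed.
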